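(* Let $X$ be a separable infinite dimensional Banach space over $\mathbb{K}$ and let $T:X\to X$ be a bounded linear operator. Assume that there is a dense linear subspace $F$ of $X$ with $T(F)\subseteq F$ such that: (B1) $F$ carries an inner product $\langle\cdot,\cdot\rangle$ such that the topology on $F$ defined by the norm $\|x\|_0=\sqrt{\langle x,x\rangle}$ is (not necessarily strictly) stronger than the topology that $F$ inherits from the norm of $X$; (B2') the restriction of $T$ to $F$ is an isometry of the normed space $(F,\|\cdot\|_0)$, and $\langle T^nx,y\rangle\to 0$ as $n\to\infty$ for every $x,y\in F$; (B3') for every $x\in F$ there is a backward $T$-orbit of $x$ containing $0$ in its norm closure in $X$. Then $T$ is weakly hypercyclic.
   Context: $\mathbb{K}$ denotes either $\mathbb{R}$ or $\mathbb{C}$. For $x\in X$, the orbit is $O(T,x)=\{T^nx:n\in\mathbb{Z}_+\}$. $T$ is weakly hypercyclic if there is $x\in X$ whose orbit $O(T,x)$ is dense in $X$ with respect to the weak topology of $X$. A backward $T$-orbit of $x$ is a sequence $\{x_n\}_{n\in\mathbb{Z}_+}$ in $X$ with $x_0=x$ and $Tx_{n+1}=x_n$ for every $n\in\mathbb{Z}_+$. *)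

(* Defs.v *)
From mathcomp Require Import all_boot all_order all_algebra.
From mathcomp Require Import all_classical all_reals all_analysis.
From mathcomp Require Import complex.
Set Implicit Arguments. Unset Strict Implicit. Unset Printing Implicit Defensive.
Import Order.TTheory GRing.Theory Num.Theory.
Import numFieldNormedType.Exports.
Local Open Scope ring_scope.
Local Open Scope classical_set_scope.

Definition is_linear (K : numFieldType) (U V : lmodType K) (f : U -> V) :=
  forall (a : K) (u v : U), f (a *: u + v) = a *: f u + f v.

Definition is_subspace (K : numFieldType) (X : lmodType K) (F : set X) :=
  F 0 /\ forall (a : K) (u v : X), F u -> F v -> F (a *: u + v).

Definition separable (K : numFieldType) (X : normedModType K) :=
  exists D : set X, countable D /\ dense D.

Definition infinite_dimensional (K : numFieldType) (X : lmodType K) :=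
  forall n : nat, exists v : 'I_n -> X,
    forall c : 'I_n -> K, \sum_(i < n) c i *: v i = 0 -> forall i, c i = 0.

Definition bounded_op (K : numFieldType) (X : normedModType K) (T : X -> X) :=
  exists M : K, forall x : X, `|T x| <= M * `|x|.

Definition orbit (X : Type) (T : X -> X) (x : X) : set X :=
  [set T' | exists n : nat, T' = iter n T x].

(* A is dense for the weak topology sigma(X, X^* ) of X, i.e. it meets every
   basic weak neighbourhood
   { z | forall i < k, |f_i z - f_i x| < e },  f_i continuous linear functionals. *)
Definition weakly_dense (K : numFieldType) (X : normedModType K) (A : set X) :=
  forall (x : X) (k : nat) (f : 'I_k -> X -> K),
    (forall i, @is_linear K X K^o (f i)) -> (forall i, continuous (f i)) ->
    forall e : K, 0 < e ->
    exists2 z, A z & forall i, `|f i z - f i x| < e.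

Definition weakly_hypercyclic (K : numFieldType) (X : normedModType K)
    (T : X -> X) := exists x : X, weakly_dense (orbit T x).

Definition backward_orbit (X : Type) (T : X -> X) (x : X) (xs : nat -> X) :=
  xs 0%N = x /\ forall n, T (xs n.+1) = xs n.

(* The statement of Theorem 1.3, over a field K with conjugation [conj]
   (identity for K = R, complex conjugation for K = C).
   ip is the inner product on F, n0 x = sqrt <x,x> is its norm
   (characterised as the nonnegative element of K whose square is <x,x>). *)
Definition theorem1p3_statement (K : numFieldType) (conj : K -> K)
    (X : completeNormedModType K) : Prop :=
  separable X -> infinite_dimensional X ->
  forall T : X -> X, is_linear T -> bounded_op T ->
  forall F : set X, is_subspace F -> dense F -> T @` F `<=` F ->
  forall (ip : X -> X -> K) (n0 : X -> K),
    (forall (a : K) (x y z : X), F x -> F y -> F z ->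
        ip (a *: x + y) z = a * ip x z + ip y z) ->
    (forall x y, F x -> F y -> ip y x = conj (ip x y)) ->
    (forall x, F x -> 0 <= ip x x) ->
    (forall x, F x -> ip x x = 0 -> x = 0) ->
    (forall x, F x -> 0 <= n0 x /\ n0 x ^+ 2 = ip x x) ->
  (* (B1): the n0-topology on F is stronger than the one induced by X,
     i.e. the identity (F, n0) -> (F, |.|) is continuous *)
    (forall x, F x -> forall e : K, 0 < e -> exists2 d : K, 0 < d &
        forall y, F y -> n0 (y - x) < d -> `|y - x| < e) ->
    (forall x, F x -> n0 (T x) = n0 x) ->
    (forall x y, F x -> F y -> (fun n : nat => ip (iter n T x) y) @ \oo --> 0) ->
    (forall x, F x -> exists xs : nat -> X,
        backward_orbit T x xs /\ closure (range xs) 0) ->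
  weakly_hypercyclic T.

(* Main.v *)
(** Let S choose preimages along backward orbits: T^m (S_m y) = y with S_m y
small. Take x = sum_k S_{m_k} y_k with m_k growing fast, where the y_k run
through a dense sequence of F. Then T^{m_k} x is y_k plus a small tail plus
the error h_k = sum_{j<k} T^{m_k - m_j} y_j. Since T is an isometry of F whose
powers tend weakly to 0, the h_k are almost orthogonal and |h_k|_0^2 is close
to sum_{j<k} |y_j|_0^2, which is O(k) if large vectors appear late in the
enumeration. By Bessel, sum_k |f(h_k)|^2 / k is finite for each functional f,
while 1/k is not summable over the set of times at which a given vector is
approached; so along these times h_k comes weakly close to 0.

All estimates take place over the reals, with the form Re <.,.>; a complex
space is viewed as a real one. *)
Require Import Defs.
From HB Require Import structures.
From mathcomp Require Import all_boot all_order all_algebra.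
From mathcomp Require Import all_classical all_reals all_analysis.
From mathcomp Require Import complex.
From mathcomp Require Import zify ring lra.
Set Implicit Arguments. Unset Strict Implicit. Unset Printing Implicit Defensive.
Import Order.TTheory GRing.Theory Num.Theory.
Import numFieldNormedType.Exports.
Local Open Scope ring_scope.
Local Open Scope classical_set_scope.

(** * Linear subspaces and linear maps *)

Section Subspace.
Variables (K : numFieldType) (X : lmodType K) (F : set X).
Hypothesis F_sub : is_subspace F.

Lemma subspace0 : F 0. Proof. by case: F_sub. Qed.

Lemma subspaceD x y : F x -> F y -> F (x + y).
Proof. by move=> Fx Fy; rewrite -[x]scale1r; apply: F_sub.2. Qed.

Lemma subspaceZ a x : F x -> F (a *: x).
Proof. by move=> Fx; rewrite -[_ *: _]addr0; apply: F_sub.2 => //; apply: subspace0. Qed.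

Lemma subspaceB x y : F x -> F y -> F (x - y).
Proof. by move=> Fx Fy; apply: subspaceD => //; rewrite -scaleN1r; apply: subspaceZ. Qed.

Lemma subspace_sum n (u : nat -> X) :
  (forall k, F (u k)) -> F (\sum_(k < n) u k).
Proof.
move=> Fu; elim: n => [|n IHn]; first by rewrite big_ord0; exact: subspace0.
by rewrite big_ord_recr; apply: subspaceD.
Qed.

End Subspace.

Section LinearMap.
Variables (K : numFieldType) (U V : lmodType K) (f : U -> V).
Hypothesis f_lin : is_linear f.

Lemma is_linearD x y : f (x + y) = f x + f y.
Proof. by rewrite -[x]scale1r f_lin !scale1r. Qed.

Lemma is_linear0 : f 0 = 0.
Proof. by apply: (addrI (f 0)); rewrite -is_linearD !addr0. Qed.

Lemma is_linearZ a x : f (a *: x) = a *: f x.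
Proof. by rewrite -[a *: x]addr0 f_lin is_linear0 addr0. Qed.

Lemma is_linearB x y : f (x - y) = f x - f y.
Proof. by rewrite is_linearD -scaleN1r is_linearZ scaleN1r. Qed.

Lemma is_linear_sum n (u : nat -> U) : f (\sum_(k < n) u k) = \sum_(k < n) f (u k).
Proof.
elim: n => [|n IHn]; first by rewrite !big_ord0 is_linear0.
by rewrite !big_ord_recr is_linearD IHn.
Qed.

End LinearMap.

Lemma is_linear_iter (K : numFieldType) (V : lmodType K) (T : V -> V) n :
  is_linear T -> is_linear (iter n T).
Proof. by move=> Tl; elim: n => [|n IHn] a u v //=; rewrite IHn Tl. Qed.

(** * Symmetric bilinear forms on a subspace; Bessel's inequality *)

Section Form.
Variables (R : realType) (V : lmodType R) (F : set V) (B : V -> V -> R).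
Hypothesis F_sub : is_subspace F.
Hypothesis B_lin : forall (a : R) x y z, F x -> F y -> F z ->
  B (a *: x + y) z = a * B x z + B y z.
Hypothesis B_sym : forall x y, F x -> F y -> B y x = B x y.

Lemma innerDl x y z : F x -> F y -> F z -> B (x + y) z = B x z + B y z.
Proof. by move=> Fx Fy Fz; rewrite -[x]scale1r B_lin // scale1r mul1r. Qed.

Lemma inner0l z : F z -> B 0 z = 0.
Proof.
move=> Fz; have F0 := subspace0 F_sub.
by apply: (addrI (B 0 z)); rewrite -innerDl // !addr0.
Qed.

Lemma innerZl a x z : F x -> F z -> B (a *: x) z = a * B x z.
Proof.
move=> Fx Fz; have F0 := subspace0 F_sub.
by rewrite -[a *: x]addr0 B_lin // inner0l // addr0.
Qed.

Lemma innerZZ a x : F x -> B (a *: x) (a *: x) = a ^+ 2 * B x x.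
Proof.
move=> Fx; have Fax : F (a *: x) by exact: (subspaceZ F_sub).
by rewrite innerZl // B_sym // innerZl // expr2 mulrA.
Qed.

Lemma inner_suml n (u : nat -> V) z : (forall k, F (u k)) -> F z ->
  B (\sum_(k < n) u k) z = \sum_(k < n) B (u k) z.
Proof.
move=> Fu Fz; elim: n => [|n IHn]; first by rewrite !big_ord0 inner0l.
by rewrite !big_ord_recr innerDl ?IHn //; exact: (subspace_sum F_sub).
Qed.

Lemma innerDD x y : F x -> F y ->
  B (x + y) (x + y) = B x x + 2 * B x y + B y y.
Proof.
move=> Fx Fy; have Fxy := subspaceD F_sub Fx Fy.
rewrite innerDl // [B x _]B_sym // [B y _]B_sym // !innerDl // (@B_sym x y) //; ring.
Qed.

(* The usual proof of Bessel's inequality: test f on sum_k (f (h k) / s k) h k;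
   the decay imposed on B (h k) (h l) makes the cross terms summable. *)
Lemma almost_orthogonal_bessel (h : nat -> V) (s : nat -> R) (f : V -> R) (C : R) :
  (forall k, F (h k)) -> (forall k, 1 <= s k) ->
  (forall k, B (h k) (h k) <= s k) ->
  (forall k l, (l < k)%N -> `|B (h k) (h l)| <= 2^-1 ^+ k / k.+1%:R) ->
  @is_linear R V R^o f -> 0 <= C ->
  (forall x, F x -> f x ^+ 2 <= C * B x x) ->
  forall n, \sum_(k < n) f (h k) ^+ 2 / s k <= C + 4 * (1 + C) ^+ 2.
Proof.
move=> Fh s1 hs hh f_lin C0 fC n.
pose a k := f (h k) / s k; pose A := 1 + C.
have A0 : 0 <= A by rewrite addr_ge0.
have s0 k : 0 < s k by apply: lt_le_trans (s1 k).
(* Here [f (h k) ^+ 2 <= C * s k], and [s k >= 1] gives [C * s k <= (1 + C) ^+ 2 * s k ^+ 2]. *)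
have aA k : `|a k| <= A.
  rewrite -(@ler_pXn2r _ 2) ?nnegrE ?normr_ge0 ?/A ?addr_ge0 // real_normK ?num_real //.
  rewrite /a expr_div_n ler_pdivrMr ?exprn_gt0 //.
  have := fC _ (Fh k); have := hs k; have := s1 k.
  move: (B _ _) (s k) (f _) => b t g t1 bt gb.
  have : C * b <= C * t by apply: ler_wpM2l.
  have : C * t <= C * t ^+ 2 by apply: ler_wpM2l => //; nra.
  have : C * t ^+ 2 <= (1 + C) ^+ 2 * t ^+ 2 by apply: ler_wpM2r; nra.
  lra.
pose u k := a k *: h k; pose w m := \sum_(k < m) u k.
pose Q m := \sum_(k < m) f (h k) ^+ 2 / s k.
have Fu k : F (u k) by exact: (subspaceZ F_sub).
have Fw m : F (w m) by exact: (subspace_sum F_sub).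
have fw m : f (w m) = Q m.
  rewrite is_linear_sum //; apply: eq_bigr => k _.
  by rewrite is_linearZ // /a /GRing.scale /= expr2; ring.
(* The sum has [m] terms, which the factor [1 / m.+1] in the decay hypothesis absorbs. *)
have Bw m : `|B (w m) (h m)| <= A * 2^-1 ^+ m.
  rewrite inner_suml //; apply: le_trans (ler_norm_sum _ _ _) _.
  apply: (@le_trans _ _ (\sum_(k < m) A * (2^-1 ^+ m / m.+1%:R))).
    apply: ler_sum => k _; rewrite innerZl // normrM.
    by apply: ler_pM => //; rewrite -B_sym //; apply: hh.
  rewrite sumr_const card_ord -[_ *+ m]mulr_natr -mulrA ler_wpM2l //.
  rewrite -mulrA ler_piMr ?exprn_ge0 ?invr_ge0 ?ler0n //.
  by rewrite mulrC ler_pdivrMr ?ltr0n // mul1r ler_nat.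
(* Passing to [m.+1], the square of the new term is at most the new term of [Q]; the doubled cross
   term is at most [2 * A ^+ 2 * 2^-1 ^+ m], the increment of the last summand. *)
have qw m : B (w m) (w m) <= Q m + 4 * A ^+ 2 * (1 - 2^-1 ^+ m).
  elim: m => [|m IHm].
    by rewrite /w /Q !big_ord0 inner0l ?expr0 ?subrr ?mulr0 ?addr0 //;
      exact: (subspace0 F_sub).
  have -> : w m.+1 = w m + u m by rewrite /w big_ord_recr.
  have -> : Q m.+1 = Q m + f (h m) ^+ 2 / s m by rewrite /Q big_ord_recr.
  rewrite innerDD // -B_sym // [B (u m) (u m)]innerZZ // innerZl //.
  have e1 : a m ^+ 2 * B (h m) (h m) <= f (h m) ^+ 2 / s m.
    have -> : f (h m) ^+ 2 / s m = a m ^+ 2 * s m.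
      by rewrite /a; field; rewrite gt_eqF.
    by rewrite ler_wpM2l // sqr_ge0.
  have e2 : a m * B (h m) (w m) <= A ^+ 2 * 2^-1 ^+ m.
    apply: le_trans (ler_norm _) _; rewrite normrM expr2 -mulrA.
    by apply: ler_pM => //; rewrite -B_sym.
  rewrite [2^-1 ^+ m.+1]exprS; lra.
have D0 : 0 <= 4 * A ^+ 2 by rewrite mulr_ge0 ?sqr_ge0.
have Qn := fC _ (Fw n); rewrite fw in Qn.
have Qn' : Q n ^+ 2 <= C * (Q n + 4 * A ^+ 2).
  apply: le_trans Qn _; rewrite ler_wpM2l //; apply: le_trans (qw n) _.
  by rewrite lerD2l ler_piMr // lerBlDr lerDl exprn_ge0 // invr_ge0.
(* With D = 4A^2, a value Q > C + D would give Q^2 > (C + D)Q >= C(Q + D), against [Qn']. *)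
rewrite -/(Q n) -/A leNgt; apply/negP => lt.
move: (4 * _) D0 lt Qn' => D D0 lt Qn'.
have Q0 : 0 < Q n by lra.
by move: Qn' lt Q0; move: (Q n) => t Qn' lt t0; nra.
Qed.

End Form.

(** * The 2-adic valuation as an enumeration, and the harmonic series *)

(** Legendre's formula: the sum of the n / 2^k is bounded by carrying the last quotient along, since
    twice n / 2^(m+1) is at most n / 2^m. *)
Lemma logn2_fact_le n : (logn 2 n`! <= n)%N.
Proof.
rewrite logn_fact //.
suff H m : (\sum_(1 <= k < m.+1) n %/ 2 ^ k + n %/ 2 ^ m <= n)%N.
  by apply: leq_trans (H n); rewrite leq_addr.
elim: m => [|m IHm]; first by rewrite big_geq // expn0 divn1.
apply: leq_trans IHm; rewrite big_nat_recr //= -addnA leq_add2l addnn -muln2.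
by rewrite expnSr divnMA leq_trunc_div.
Qed.

(** The valuation takes each value infinitely often, yet its average stays at most 1. This keeps the
    sums of |y_j|_0^2 linear in the number of terms. *)
Lemma sum_logn2_le n : (\sum_(k < n) logn 2 k.+1 <= n)%N.
Proof.
apply: leq_trans (logn2_fact_le n); rewrite leq_eqVlt; apply/orP; left; apply/eqP.
elim: n => [|n IHn]; first by rewrite big_ord0.
by rewrite big_ord_recr /= IHn factS lognM ?fact_gt0 // addnC.
Qed.

(* An enumeration of the indices k with logn 2 k.+1 = a. *)
Definition ruler (a t : nat) : nat := (2 ^ a * t.*2.+1).-1.

Lemma rulerS a t : (ruler a t).+1 = (2 ^ a * t.*2.+1)%N.
Proof. by rewrite prednK // muln_gt0 expn_gt0. Qed.

Lemma logn_ruler a t : logn 2 (ruler a t).+1 = a.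
Proof.
rewrite rulerS lognM ?expn_gt0 // pfactorK // lognE /= dvdn2 /= odd_double /=.
by rewrite addn0.
Qed.

Lemma ltn_ruler a : {homo ruler a : t u / (t < u)%N}.
Proof.
move=> t u tu; rewrite -ltnS !rulerS ltn_pmul2l ?expn_gt0 //.
by rewrite ltnS ltn_double.
Qed.

Lemma leq_ruler a t : (t <= ruler a t)%N.
Proof.
rewrite -ltnS rulerS; apply: (@leq_trans t.*2.+1).
  by rewrite ltnS -addnn leq_addr.
by rewrite leq_pmull ?expn_gt0.
Qed.

Lemma harmonic_unbounded (R : realType) (A : R) :
  exists n, A < \sum_(t < n) t.+1%:R^-1.
Proof.
apply: contrapT => /forallNP H; apply: (@dvg_harmonic R).
have E n : series (@harmonic R) n = \sum_(t < n) t.+1%:R^-1.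
  by rewrite /series /= big_mkord.
apply: nondecreasing_is_cvgn.
  by apply/nondecreasing_seqP => n; rewrite !E big_ord_recr /= lerDl invr_ge0.
exists A => _ [n _ <-]; rewrite E leNgt; apply/negP; exact: H.
Qed.

(** * Construction of the vector with weakly dense orbit, over the reals *)

Section Construction.
Variables (R : realType) (V : lmodType R) (F : set V) (B : V -> V -> R).
Hypothesis F_sub : is_subspace F.
Hypothesis B_lin : forall (a : R) x y z, F x -> F y -> F z ->
  B (a *: x + y) z = a * B x z + B y z.
Hypothesis B_sym : forall x y, F x -> F y -> B y x = B x y.
Variables (N : V -> R) (T : V -> V) (M C0 : R).
Hypothesis N0 : N 0 = 0.
Hypothesis ND : forall x y, N (x + y) <= N x + N y.
Hypothesis NN : forall x, N (- x) = N x.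
Hypothesis NB : forall x, F x -> N x ^+ 2 <= C0 * B x x.
Hypothesis C0_ge0 : 0 <= C0.
Hypothesis N_complete : forall u : nat -> V,
  (forall k, N (u k.+1 - u k) <= 2^-1 ^+ k) ->
  exists x, forall e : R, 0 < e -> exists n, forall k, (n <= k)%N -> N (x - u k) < e.
Hypothesis T_lin : is_linear T.
Hypothesis M_ge1 : 1 <= M.
Hypothesis NT : forall x, N (T x) <= M * N x.
Hypothesis TF : forall x, F x -> F (T x).
Hypothesis BT : forall x, F x -> B (T x) (T x) = B x x.
Hypothesis T_mixing : forall x y, F x -> F y -> forall e : R, 0 < e ->
  exists n, forall m, (n <= m)%N -> `|B (iter m T x) y| < e.
Hypothesis T_backward : forall x, F x -> forall e : R, 0 < e -> forall n,
  exists m v, [/\ (n <= m)%N, iter m T v = x & N v < e].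

Let iterF n x : F x -> F (iter n T x).
Proof. by elim: n => //= n IHn /IHn /TF. Qed.

Let N_iter n x : N (iter n T x) <= M ^+ n * N x.
Proof.
elim: n => [|n IHn]; first by rewrite mul1r.
apply: le_trans (NT _) _; rewrite exprS -mulrA ler_wpM2l //.
by apply: le_trans M_ge1.
Qed.

Let B_iter n x : F x -> B (iter n T x) (iter n T x) = B x x.
Proof. by move=> Fx; elim: n => //= n <-; rewrite BT //; exact: iterF. Qed.

Lemma mixing_seq x (E : seq V) e : F x -> (forall y, y \in E -> F y) -> 0 < e ->
  exists n, forall m, (n <= m)%N -> forall y, y \in E -> `|B (iter m T x) y| < e.
Proof.
move=> Fx FE e0; elim: E FE => [|z E IHE] FE; first by exists 0%N.
have [|n Hn] := IHE; first by move=> y yE; apply: FE; rewrite inE yE orbT.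
have [|n' Hn'] := T_mixing Fx (FE z _) e0; first by rewrite inE eqxx.
exists (maxn n n') => m; rewrite geq_max => /andP[nm n'm] y.
by rewrite inE => /orP[/eqP ->|yE]; [exact: Hn'|exact: Hn].
Qed.

(* In a state (k, m, u, E), u is the k-th partial sum of the vector to be
   constructed, m the k-th time, and E the list of the earlier errors. *)
Let state : Type := nat * nat * V * seq V.

(** The next time is taken so late that the image of the current vector is almost orthogonal to the
    next target and to all earlier errors. A small preimage of that target is then added to the
    partial sum. *)
Lemma construction (y : nat -> V) : (forall k, F (y k)) ->
  exists (m : nat -> nat) (u : nat -> V),
    let h k := iter (m k) T (u k) - y k in
    [/\ h 0%N = 0, forall k, F (h k),
        forall k, (m k <= m k.+1)%N /\
          h k.+1 = iter (m k.+1 - m k) T (h k + y k),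
        forall k, N (u k.+1 - u k) <= 2^-1 ^+ k.+1 / M ^+ m k &
        (forall k, `|B (h k) (y k)| <= 2^-1 ^+ k / k.+1%:R) /\
        forall k l, (l < k)%N -> `|B (h k) (h l)| <= 2^-1 ^+ k / k.+1%:R].
Proof.
move=> Fy.
pose g (s : state) := iter s.1.1.2 T s.1.2.
pose h (s : state) := g s - y s.1.1.1.
pose P (s : state) := F (g s) /\ forall e, e \in s.2 -> F e.
pose del k : R := 2^-1 ^+ k / k.+1%:R.
(* Conditioning on [P s] gives every state a successor, as [dependent_choice] demands; [Pf] then
   discharges the condition along the chosen sequence. *)
pose r (s s' : state) := P s -> P s' /\
  [/\ s'.1.1.1 = s.1.1.1.+1, s'.2 = h s :: s.2,
      (s.1.1.2 <= s'.1.1.2)%N /\ h s' = iter (s'.1.1.2 - s.1.1.2) T (g s),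
      N (s'.1.2 - s.1.2) <= 2^-1 ^+ s'.1.1.1 / M ^+ s.1.1.2 &
      forall e, e \in y s'.1.1.1 :: s'.2 -> `|B (h s') e| <= del s'.1.1.1].
have del_gt0 k : 0 < del k by rewrite divr_gt0 ?exprn_gt0 ?invr_gt0 ?ltr0n.
have M_gt0 n : 0 < M ^+ n by rewrite exprn_gt0 // (lt_le_trans _ M_ge1).
have ex_r s : exists s', r s s'.
  have [Ps|nPs] := pselect (P s); last by exists s.
  move: s Ps => [[[k m] u] E]; rewrite /P /r /h /g /= => -[Fg FE].
  set gs := iter m T u in Fg *.
  have Fh : F (gs - y k) by exact: (subspaceB F_sub).
  have [|n0 Hn0] := @mixing_seq gs (y k.+1 :: gs - y k :: E) (del k.+1) Fg _ (del_gt0 _).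
    by move=> e; rewrite !inE => /or3P[/eqP ->|/eqP ->|/FE].
  (* The bound [m + n0] makes the elapsed time [m' - m] at least [n0]; dividing by [M ^+ m] keeps
     the correction small after [m] applications of [T]. *)
  have [|m' [v [mm' Tv Nv]]] :=
    T_backward (Fy k.+1) (e := 2^-1 ^+ k.+1 / M ^+ m) _ (m + n0).
    by rewrite divr_gt0 // exprn_gt0 // invr_gt0.
  have mm : (m <= m')%N by apply: leq_trans mm'; rewrite leq_addr.
  have Tu : iter m' T (u + v) = iter (m' - m) T gs + y k.+1.
    by rewrite is_linearD ?Tv; [rewrite -{1}(subnK mm) iterD|exact: is_linear_iter].
  exists (k.+1, m', u + v, gs - y k :: E) => _ /=; rewrite Tu addrK.
  split; first split.
  - by rewrite /g /= Tu; apply: (subspaceD F_sub) => //; exact: iterF.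
  - by move=> e; rewrite inE => /orP[/eqP ->|/FE].
  split=> //; first by rewrite addrC addKr ltW.
  by move=> e eE; rewrite ltW // Hn0 // leq_subRL.
have [f [f0 fr]] :=
  dependent_choice (fun s => cid (ex_r s)) (0%N, 0%N, y 0%N, [::]).
have Pf k : P (f k).
  elim: k => [|k IHk]; last by have [] := fr k IHk.
  by rewrite f0; split => //=; exact: Fy.
have fr' k := (fr k (Pf k)).2.
have fk k : (f k).1.1.1 = k.
  by elim: k => [|k IHk]; [rewrite f0|have [-> _ _ _ _] := fr' k; rewrite IHk].
exists (fun k => (f k).1.1.2), (fun k => (f k).1.2) => hh.
have hE k : hh k = h (f k) by rewrite /hh /h /g fk.
have gE k : hh k + y k = g (f k) by rewrite hE /h fk subrK.
have Fh k : F (hh k) by rewrite hE; apply: (subspaceB F_sub) => //; case: (Pf k).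
have h0 : hh 0%N = 0 by rewrite /hh f0 /= subrr.
have Eh l k : (l < k)%N -> hh l \in (f k).2.
  elim: k => // k IHk; have [_ -> _ _ _] := fr' k; rewrite ltnS leq_eqVlt inE.
  by case/orP => [/eqP ->|/IHk ->]; rewrite ?hE ?eqxx ?orbT.
split=> //.
- by move=> k; rewrite hE gE; have [_ _ [le ->] _ _] := fr' k; split.
- by move=> k; have [_ _ _ + _] := fr' k; rewrite fk.
split=> [[|k]|[|k] l lk] //.
- by rewrite h0 (inner0l F_sub) // normr0 ltW.
- by have [_ _ _ _ +] := fr' k; rewrite fk hE; apply; rewrite inE eqxx.
- have [_ _ _ _ +] := fr' k; rewrite fk [hh k.+1]hE; apply.
  by rewrite inE Eh ?orbT.
Qed.

(** [x] is the limit of the partial sums [u k]. The factor [M ^+ m k] in the bound on the tail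
    [x - u k] cancels the growth of [T] over [m k] steps. *)
Lemma approximating_vector (y : nat -> V) : (forall k, F (y k)) ->
  exists (x : V) (m : nat -> nat) (h : nat -> V),
    [/\ forall k, F (h k),
        forall k, N (iter (m k) T x - (y k + h k)) <= 2^-1 ^+ k,
        forall k, B (h k) (h k) <= \sum_(j < k) B (y j) (y j) + 4 &
        forall k l, (l < k)%N -> `|B (h k) (h l)| <= 2^-1 ^+ k / k.+1%:R].
Proof.
move=> Fy; have [m [u []]] := construction Fy; move=> h0 Fh hm Nu [hy hh].
have M_gt0 n : 0 < M ^+ n by rewrite exprn_gt0 // (lt_le_trans _ M_ge1).
have two_gt0 n : 0 < 2^-1 ^+ n :> R by rewrite exprn_gt0 // invr_gt0.
have [k|x ux] := N_complete (u := u).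
  apply: le_trans (Nu k) _; rewrite ler_pdivrMr //.
  apply: (@le_trans _ _ (2^-1 ^+ k)); last by rewrite ler_peMr ?exprn_ege1 // ltW.
  by rewrite exprS ler_piMl ?invf_le1 ?ler1n // ltW.
have mono : {homo m : k l / (k <= l)%N}.
  by apply: homo_leq => [k|k l j|k]; [exact: leqnn|exact: leq_trans|exact: (hm k).1].
(* A telescoping geometric sum: as [m] is nondecreasing, all later increments may be bounded with
   the denominator [M ^+ m k]. *)
have Nul k n : N (u (k + n)%N - u k) <= (2^-1 ^+ k - 2^-1 ^+ (k + n)) / M ^+ m k.
  elim: n => [|n IHn].
    by rewrite addn0 !subrr mul0r N0.
  rewrite addnS -(subrKA (u (k + n)%N)); apply: le_trans (ND _ _) _.
  have : N (u (k + n).+1 - u (k + n)%N) <= 2^-1 ^+ (k + n).+1 / M ^+ m k.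
    apply: le_trans (Nu _) _; rewrite ler_wpM2l ?(ltW (two_gt0 _)) // lef_pV2 ?posrE //.
    by rewrite ler_weXn2l // mono // leq_addr.
  rewrite exprS; lra.
have Nx k : N (x - u k) <= 2^-1 ^+ k / M ^+ m k.
  apply/ler_addgt0Pr => e e0; have [n Hn] := ux _ e0.
  have := Hn _ (leq_addl k n); have := Nul k n.
  have := ND (x - u (k + n)%N) (u (k + n)%N - u k).
  rewrite subrKA mulrBl; have := divr_ge0 (ltW (two_gt0 (k + n)%N)) (ltW (M_gt0 (m k))).
  lra.
exists x, m, (fun k => iter (m k) T (u k) - y k); split => // k.
  rewrite (addrC (y k)) subrK -is_linearB; last exact: is_linear_iter.
  apply: le_trans (N_iter _ _) _.
  apply: le_trans (ler_wpM2l _ (Nx k)) _; first exact: ltW.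
  by rewrite mulrC divfK // gt_eqF.
(* The sharper bound is inductive: [T] preserves the form, and the cross term [2 * B (h k) (y k)] is
   at most [2 * 2^-1 ^+ k], exactly the increment. *)
apply: (@le_trans _ _ (\sum_(j < k) B (y j) (y j) + 4 * (1 - 2^-1 ^+ k))); last first.
  by rewrite lerD2l ler_piMr // lerBlDr lerDl ltW.
elim: k => [|k IHk].
  by rewrite big_ord0 h0 (inner0l F_sub) ?expr0 ?subrr ?mulr0 ?addr0 //;
      exact: (subspace0 F_sub).
rewrite (hm k).2 B_iter; last exact: (subspaceD F_sub).
rewrite (innerDD F_sub) // big_ord_recr /= exprS.
have d_le : 2^-1 ^+ k / k.+1%:R <= 2^-1 ^+ k :> R.
  by rewrite ler_pdivrMr ?ltr0n // ler_peMr ?ler1n // ltW.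
have := le_trans (le_trans (ler_norm _) (hy k)) d_le.
move: IHk; set S := \sum_(j < k) _; lra.
Qed.

(* The orbit hits the weak neighbourhood at the times k = ruler i t, when the
   error h k is small on the finitely many f j: otherwise e^2/9 <= sum_j f j (h k)^2
   for all these k, while Bessel bounds sum_k f j (h k)^2 / (2k + 4) and
   the sum of 1 / (2k + 4) over these k diverges. *)
Lemma real_weakly_dense_orbit (z : nat -> V) : (forall a, F (z a)) ->
  (forall x e, 0 < e -> exists a, N (x - z a) < e) ->
  exists x, forall (x0 : V) (I : finType) (f : I -> V -> R),
    (forall j, @is_linear R V R^o (f j)) ->
    (forall j, exists c, forall v, `|f j v| <= c * N v) ->
    forall e, 0 < e -> exists n, forall j, `|f j (iter n T x) - f j x0| < e.
Proof.
move=> Fz z_dense.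
pose q x := B x x.
(* Two nested enumerations: [z'] lists each [z a] infinitely often but delays it until the index
   dominates its squared norm, and [y] repeats each [z' i] along an arithmetic progression. Hence
   the sum of the [q (y j)] over j < k is at most 2k. *)
pose z' i := if q (z (logn 2 i.+1)) <= i.+1%:R then z (logn 2 i.+1) else 0.
pose y k := z' (logn 2 k.+1).
have F0 : F 0 by exact: (subspace0 F_sub).
have Fz' i : F (z' i) by rewrite /z'; case: ifP.
have qz' i : q (z' i) <= i.+1%:R.
  by rewrite /z'; case: ifP => // _; rewrite /q (inner0l F_sub).
have qy k : \sum_(j < k) q (y j) <= k.*2%:R.
  apply: (@le_trans _ _ (\sum_(j < k) (logn 2 j.+1).+1%:R)).
    by apply: ler_sum => j _; exact: qz'.
  rewrite -natr_sum ler_nat -addnn; under eq_bigr do rewrite -addn1.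
  by rewrite big_split /= sum1_card card_ord leq_add2r sum_logn2_le.
have [x [m [h [Fh Nx qh hh]]]] := @approximating_vector y (fun k => Fz' _).
exists x => x0 I f f_lin f_bd e e0.
have [c cP] := choice f_bd.
pose D := 1 + \sum_j `|c j|.
have D1 : 1 <= D by rewrite lerDl sumr_ge0.
have D0 : 0 < D by apply: lt_le_trans D1.
have N_ge0 v : 0 <= N v.
  by have := ND v (- v); rewrite subrr N0 NN; lra.
have fD j v : `|f j v| <= D * N v.
  apply: le_trans (cP j v) _; rewrite ler_wpM2r //; apply: le_trans (ler_norm _) _.
  by rewrite /D (bigD1 j) //= addrCA lerDl addr_ge0 // sumr_ge0.
(* Each of three errors gets e/3: the remainder of [x], the distance from [z a] to [x0], and [h].
   [D] is a common bound for all the functionals. *)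
have e3 : 0 < e / (3 * D) by rewrite divr_gt0 // mulr_gt0.
have [a za] := z_dense x0 _ e3.
(* This [i] has valuation index [a] and exceeds [q (z a)], so the cutoff in [z'] is inactive and
   [z' i] is [z a]. *)
pose i := ruler a (Num.bound `|q (z a)|).
have yi t : y (ruler i t) = z a.
  rewrite /y logn_ruler /z' /i logn_ruler ifT //.
  apply: le_trans (ler_norm _) _; apply: le_trans (ltW (archi_boundP (normr_ge0 _))) _.
  by rewrite ler_nat leqW // leq_ruler.
have [K HK] : exists K, forall k, (K <= k)%N -> 2^-1 ^+ k < e / (3 * D).
  have : (fun k => 2^-1 ^+ k : R) @ \oo --> 0.
    by apply: cvg_expr; rewrite ger0_norm ?invr_ge0 // invf_lt1 // ltr1n.
  move/cvgr0Pnorm_lt => /(_ _ e3) [K _ HK]; exists K => k Kk.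
  exact: le_lt_trans (ler_norm _) (HK k Kk).
pose p t := ruler i (t + K).
have pK t : (K <= p t)%N by apply: leq_trans (leq_ruler _ _); rewrite leq_addl.
suff [t ht] : exists t, forall j, `|f j (h (p t))| < e / 3.
  exists (m (p t)) => j.
  have f_small v : N v < e / (3 * D) -> `|f j v| < e / 3.
    by move=> Nv; apply: le_lt_trans (fD j v) _;
      rewrite -ltr_pdivlMl // mulrC -mulrA -invfM.
  have := f_small _ (le_lt_trans (Nx (p t)) (HK _ (pK t))).
  have := f_small _ za; have := ht j.
  rewrite /p yi -/(p t) !(is_linearB (f_lin j)) (is_linearD (f_lin j)).
  by rewrite !ltr_norml; lra.
apply: contrapT => /forallNP H.
have H' t : (e / 3) ^+ 2 <= \sum_j f j (h (p t)) ^+ 2.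
  have /existsNP[j /negP] := H t; rewrite -leNgt => le.
  rewrite (bigD1 j) //= -[leLHS]addr0 lerD ?sumr_ge0 // => [|l _]; last exact: sqr_ge0.
  by rewrite -[_ ^+ 2 in leRHS]real_normK ?num_real // lerXn2r ?nnegrE // divr_ge0 // ltW.
pose s t : R := (p t).*2%:R + 4.
have s1 t : 1 <= s t.
  by have := ler0n R (p t).*2; rewrite /s; lra.
pose C j := `|c j| ^+ 2 * C0.
have C_ge0 j : 0 <= C j by rewrite mulr_ge0 // exprn_ge0.
have fC j v : F v -> f j v ^+ 2 <= C j * B v v.
  move=> Fv; rewrite /C -mulrA -[_ ^+ 2]real_normK ?num_real //.
  apply: le_trans (ler_wpM2l _ (NB Fv)); last exact: exprn_ge0.
  rewrite -exprMn lerXn2r ?nnegrE ?mulr_ge0 //.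
  by apply: le_trans (cP j v) _; rewrite ler_wpM2r // ler_norm.
have p_lt : {homo p : t u / (t < u)%N}.
  by move=> t u tu; apply: ltn_ruler; rewrite ltn_add2r.
have p_ge t : (t <= p t)%N by apply: leq_trans (leq_ruler _ _); rewrite leq_addr.
(* The decay of the inner products passes to the subsequence [h \o p] because [p] is increasing and
   [t <= p t]. *)
have bessel j n : \sum_(t < n) f j (h (p t)) ^+ 2 / s t <= C j + 4 * (1 + C j) ^+ 2.
  apply: (almost_orthogonal_bessel F_sub B_lin B_sym (h := h \o p)) => //=.
  - by move=> t; apply: le_trans (qh _) _; rewrite lerD2r qy.
  - move=> t u ut; apply: le_trans (hh _ _ (p_lt _ _ ut)) _.
    apply: ler_pM; rewrite ?exprn_ge0 ?invr_ge0 //.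
      by rewrite ler_wiXn2l ?invr_ge0 ?invf_le1 ?ler1n.
    by rewrite lef_pV2 ?posrE // ler_nat ltnS.
  - by move=> v; exact: fC.
(* By [rulerS], [s t] equals 2^(i+1) (2(t + K) + 1) + 2, which is at most [d * t.+1%:R]. *)
pose d : R := (2 ^ i.+1 * K.*2.+2 + 2)%N%:R.
have d_gt0 : 0 < d by rewrite ltr0n addn_gt0 orbT.
have sd t : s t <= d * t.+1%:R.
  rewrite /s /d -natrM -[4]/(4%:R) -natrD ler_nat.
  have := rulerS i (t + K); rewrite -/(p t) expnS.
  have : (0 < 2 ^ i)%N by rewrite expn_gt0.
  move: (2 ^ i)%N => w; rewrite -!muln2; nia.
pose S := \sum_j (C j + 4 * (1 + C j) ^+ 2).
have [L HL] := harmonic_unbounded (S * d / (e / 3) ^+ 2).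
have e2 : 0 < (e / 3) ^+ 2 by rewrite exprn_gt0 // divr_gt0.
move: HL; rewrite ltr_pdivrMr // ltNge => /negP; apply.
rewrite -ler_pdivrMr // -mulrA mulr_suml.
have : \sum_(t < L) \sum_j f j (h (p t)) ^+ 2 / s t <= S.
  by rewrite exchange_big /=; apply: ler_sum => j _; exact: bessel.
apply: le_trans; apply: ler_sum => t _; rewrite -mulr_suml.
apply: (@le_trans _ _ ((e / 3) ^+ 2 / s t)); last first.
  by rewrite ler_wpM2r // invr_ge0 (le_trans _ (s1 t)).
rewrite mulrCA ler_pM2l // -invfM [_ * d]mulrC lef_pV2 ?posrE ?mulr_gt0 //.
exact: lt_le_trans (s1 t).
Qed.

End Construction.

(** * Restriction of scalars to the reals *)

(** An alias of [X] that can carry a second module structure; [iota] is a parameter because the real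
    scaling depends on it. *)
Definition realify (R : realType) (K : numFieldType) (iota : {rmorphism R -> K})
  (X : lmodType K) : Type := X.

Section Realify.
Variables (R : realType) (K : numFieldType) (iota : {rmorphism R -> K}).
Variable X : lmodType K.
Local Notation XR := (realify iota X).

HB.instance Definition _ := GRing.Zmodule.on XR.

Let scale (r : R) (x : XR) : XR := iota r *: (x : X).

Fact realify_scaleA a b v : scale a (scale b v) = scale (a * b) v.
Proof. by rewrite /scale scalerA rmorphM. Qed.

Fact realify_scale1 : left_id 1 scale.
Proof. by move=> v; rewrite /scale rmorph1 scale1r. Qed.

Fact realify_scaleDr : right_distributive scale +%R.
Proof. by move=> a u v; rewrite /scale scalerDr. Qed.

Fact realify_scaleDl v : {morph scale^~ v : a b / a + b}.
Proof. by move=> a b; rewrite /scale rmorphD scalerDl. Qed.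

HB.instance Definition _ := GRing.Zmodule_isLmodule.Build R XR
  realify_scaleA realify_scale1 realify_scaleDr realify_scaleDl.

Lemma realify_scaleE (r : R) (x : XR) : r *: x = iota r *: (x : X).
Proof. by []. Qed.

End Realify.

(** Rescale [x] so that [p] becomes d/2. If [p x] is 0, a positive [g x] could be scaled to 1, which
    the hypothesis excludes. The lemma serves both for (B1) and for continuous functionals. *)
Lemma homogeneous_bound (R : realType) (V : lmodType R) (F : set V) (p g : V -> R) d :
  is_subspace F -> 0 < d ->
  (forall r x, F x -> p (r *: x) = `|r| * p x) ->
  (forall r x, F x -> g (r *: x) = `|r| * g x) ->
  (forall x, F x -> 0 <= p x) -> (forall x, F x -> p x < d -> g x < 1) ->
  forall x, F x -> g x <= 2 / d * p x.
Proof.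
move=> F_sub d0 pZ gZ p0 pg x Fx.
have Frx r : F (r *: x) by exact: (subspaceZ F_sub).
have [px0|px0] := eqVneq (p x) 0.
  rewrite px0 mulr0 leNgt; apply/negP => gx.
  have := pg _ (Frx (g x)^-1); rewrite pZ // gZ // px0 mulr0 => /(_ d0).
  by rewrite gtr0_norm ?invr_gt0 // mulVf ?ltxx // gt_eqF.
have px : 0 < p x by rewrite lt_def px0 p0.
have r0 : 0 < d / (2 * p x) by rewrite divr_gt0 // mulr_gt0.
have := pg _ (Frx (d / (2 * p x))); rewrite pZ // gZ // gtr0_norm //.
have -> : d / (2 * p x) * p x = d / 2 by field.
move=> /(_ _) /[dup] + _ => /(_ _) H; have {}H := H (ltac:(lra)).
have -> : 2 / d * p x = (d / (2 * p x))^-1 by field; rewrite px0 gt_eqF.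
by rewrite -[leRHS]mulr1 ler_pdivlMl // ltW.
Qed.

Lemma dense_ball (K : numFieldType) (X : normedModType K) (D : set X) x (e : K) :
  dense D -> 0 < e -> exists2 y, D y & `|x - y| < e.
Proof.
move=> dD e0; have [||y [/interior_subset xy Dy]] := dD (ball x e)^°.
- by exists x; exact: nbhsx_ballx.
- exact: open_interior.
by exists y => //; move: xy; rewrite -ball_normE.
Qed.

(** * Reduction of the real and complex cases to the real construction *)

Section Reduction.
Variables (R : realType) (K : numFieldType) (iota : {rmorphism R -> K}).
Variables (re : K -> R) (c : K) (conj : K -> K).
Hypothesis reD : forall a b, re (a + b) = re a + re b.
Hypothesis re_scale : forall r a, re (iota r * a) = r * re a.
Hypothesis ge0_reK : forall a, 0 <= a -> iota (re a) = a.
Hypothesis ler_iota : forall r s, (iota r <= iota s) = (r <= s).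
Hypothesis norm_re_le : forall a, `|re a| <= re `|a|.
(* For the complex field c = -i, so that re (c * a) is the imaginary part of a. *)
Hypothesis re_norm_le : forall a, re `|a| <= `|re a| + `|re (c * a)|.
Hypothesis re_conj : forall a, re (conj a) = re a.

Lemma re1 : re 1 = 1.
Proof. by apply: (fmorph_inj iota); rewrite ge0_reK ?ler01 // rmorph1. Qed.

Lemma iotaK : cancel iota re.
Proof. by move=> r; rewrite -[iota r]mulr1 re_scale re1 mulr1. Qed.

Lemma re0 : re 0 = 0. Proof. by rewrite -(rmorph0 iota) iotaK. Qed.

Lemma reB a b : re (a - b) = re a - re b.
Proof. by apply/eqP; rewrite eq_sym subr_eq -reD subrK. Qed.

Lemma re_ge0 a : 0 <= a -> 0 <= re a.
Proof. by move=> a0; rewrite -ler_iota rmorph0 ge0_reK. Qed.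

Lemma re_le a b : a <= b -> re a <= re b.
Proof. by rewrite -subr_ge0 => /re_ge0; rewrite reB subr_ge0. Qed.

Lemma ltr_iota r s : (iota r < iota s) = (r < s).
Proof. by rewrite !lt_def ler_iota (inj_eq (fmorph_inj iota)). Qed.

Lemma iota_gt0 r : (0 < iota r) = (0 < r).
Proof. by rewrite -(rmorph0 iota) ltr_iota. Qed.

Lemma re_gt0 a : 0 < a -> 0 < re a.
Proof. by move=> a0; rewrite -iota_gt0 ge0_reK // ltW. Qed.

Lemma norm_iota r : `|iota r| = iota `|r|.
Proof.
have [r0|r0] := leP 0 r; first by rewrite !ger0_norm // -(rmorph0 iota) ler_iota.
rewrite !ler0_norm ?rmorphN //; first exact: ltW.
by rewrite -(rmorph0 iota) ler_iota ltW.
Qed.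

Section Norm.
Variable X : normedModType K.

Definition rnorm (x : X) : R := re `|x|.

Lemma iota_rnorm x : iota (rnorm x) = `|x|.
Proof. exact: ge0_reK. Qed.

Lemma rnorm_lt x e : (rnorm x < e) = (`|x| < iota e).
Proof. by rewrite -iota_rnorm ltr_iota. Qed.

Lemma rnormZ r x : rnorm (iota r *: x) = `|r| * rnorm x.
Proof. by rewrite /rnorm normrZ norm_iota re_scale. Qed.

Lemma rnorm_ge0 x : 0 <= rnorm x. Proof. exact: re_ge0. Qed.

Lemma rnorm0 : rnorm 0 = 0. Proof. by rewrite /rnorm normr0 re0. Qed.

Lemma rnormD x y : rnorm (x + y) <= rnorm x + rnorm y.
Proof. by rewrite /rnorm -reD; apply: re_le; exact: ler_normD. Qed.

Lemma rnormN x : rnorm (- x) = rnorm x. Proof. by rewrite /rnorm normrN. Qed.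

Lemma rnorm_eq0 x : rnorm x = 0 -> x = 0.
Proof.
by move=> x0; apply/eqP; rewrite -normr_eq0 -iota_rnorm x0 rmorph0.
Qed.

Lemma continuous_linear_bounded (f : X -> K) :
  @is_linear K X K^o f -> continuous f ->
  exists C : R, forall x, re `|f x| <= C * rnorm x.
Proof.
move=> f_lin fc; have f0 := is_linear0 f_lin.
have := fc 0; rewrite /continuous_at f0 => /cvgr0Pnorm_lt /(_ 1 ltr01).
move=> /nbhs_ballP [d d0 Hd]; exists (2 / re d) => x.
apply: (@homogeneous_bound R (realify iota X) setT _ (fun x => re `|f x|)) => //.
- exact: re_gt0.
- by move=> r y _; exact: rnormZ.
- move=> r y _; rewrite realify_scaleE (is_linearZ f_lin) /GRing.scale /=.
  by rewrite normrM norm_iota re_scale.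
- by move=> y _; exact: rnorm_ge0.
move=> y _ yd; have := Hd y; rewrite -ball_normE /= sub0r normrN.
rewrite -[d]ge0_reK; last exact: ltW.
rewrite -rnorm_lt => /(_ yd) fy.
by rewrite -ltr_iota ge0_reK // rmorph1.
Qed.

End Norm.

Lemma geometric_complete (X : completeNormedModType K) (u : nat -> X) :
  (forall k, rnorm (u k.+1 - u k) <= 2^-1 ^+ k) ->
  exists x, forall e, 0 < e ->
    exists n, forall k, (n <= k)%N -> rnorm (x - u k) < e.
Proof.
move=> Hu.
have Hn k n : rnorm (u (k + n)%N - u k) <= 2 * 2^-1 ^+ k - 2 * 2^-1 ^+ (k + n).
  elim: n => [|n IHn]; first by rewrite addn0 !subrr rnorm0.
  rewrite addnS -(subrKA (u (k + n)%N)); apply: le_trans (rnormD _ _) _.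
  have := Hu (k + n)%N; rewrite [2^-1 ^+ (k + n).+1]exprS; lra.
have : cvg (u @ \oo).
  apply: cauchy_cvg; apply: cauchy_exP => e e0.
  have : (fun k => 2^-1 ^+ k : R) @ \oo --> 0.
    by apply: cvg_expr; rewrite ger0_norm ?invr_ge0 // invf_lt1 // ltr1n.
  move/cvgr0Pnorm_lt => /(_ (re e / 2)) [|k _ Hk]; first by rewrite divr_gt0 // re_gt0.
  exists (u k); exists k => // l /= kl; rewrite -ball_normE /=.
  rewrite -[e]ge0_reK; last exact: ltW.
  rewrite -rnorm_lt -rnormN opprB -(subnKC kl); apply: le_lt_trans (Hn _ _) _.
  have := le_lt_trans (ler_norm _) (Hk k (leqnn k)).
  have : 0 < 2^-1 ^+ (k + (l - k)) :> R by rewrite exprn_gt0 // invr_gt0.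
  lra.
move=> /cvg_ex [x /cvgrPdist_lt ux]; exists x => e e0.
have [|n _ H] := ux (iota e); first by rewrite iota_gt0.
by exists n => k nk; rewrite rnorm_lt; exact: H.
Qed.

(** The countable dense set need not meet [F], so each of its points is approximated from [F] to
    within every 1/(k+1). *)
Lemma separable_dense_sequence (X : normedModType K) (F : set X) :
  separable X -> dense F ->
  exists z : nat -> X, (forall a, F (z a)) /\
    forall x e, 0 < e -> exists a, rnorm (x - z a) < e.
Proof.
move=> [D [cD dD]] dF.
have [y0 Dy0 _] := dense_ball 0 dD ltr01.
have [D0|[g]] := pfcard_geP cD; first by rewrite D0 in Dy0.
have : forall p : nat * nat, exists y, F y /\ rnorm (g p.1 - y) < p.2.+1%:R^-1.
  move=> p; have [|y Fy gy] := @dense_ball _ _ F (g p.1) (iota p.2.+1%:R^-1) dF.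
    by rewrite iota_gt0 invr_gt0 ltr0n.
  by exists y; rewrite rnorm_lt.
move=> /choice [w Hw].
exists (fun a => w (odflt (0, 0)%N (unpickle a))); split=> [a|x e e0].
  exact: (Hw _).1.
have e2 : 0 < iota (e / 2) by rewrite iota_gt0 divr_gt0.
have [y Dy xy] := dense_ball x dD e2.
have [n _ ny] : exists2 n, True & g n = y.
  by have [n nT gn] := @surj _ _ _ _ g y Dy; exists n.
have [k Hk] : exists k, k.+1%:R^-1 < e / 2.
  exists (Num.bound (e / 2)^-1); rewrite invf_plt ?posrE ?divr_gt0 ?ltr0n //.
  apply: lt_le_trans (archi_boundP _) _; first by rewrite invr_ge0 divr_ge0 // ltW.
  by rewrite ler_nat.
exists (pickle (n, k)); rewrite pickleK /=.
have yw : rnorm (y - w (n, k)) < e / 2.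
  by apply: lt_trans Hk; have := (Hw (n, k)).2; rewrite /= ny.
rewrite -(subrKA y) [e]splitr; apply: le_lt_trans (rnormD _ _) _.
by rewrite ltrD // rnorm_lt.
Qed.

Lemma weakly_hypercyclic_criterion (X : completeNormedModType K) :
  theorem1p3_statement conj X.
Proof.
move=> X_sep _ T T_lin [M0 TM] F F_sub F_dense TF ip n0 ip_lin ip_sym ip_ge0 ip_def
  n0P B1 B2 B2' B3.
pose B x y := re (ip x y).
have F0 : F 0 by exact: (subspace0 F_sub).
have FT x : F x -> F (T x) by move=> Fx; apply: TF; exists x.
have n0E x : F x -> n0 x = iota (Num.sqrt (B x x)).
  move=> Fx; have [n0x n0x2] := n0P x Fx; rewrite -[LHS]ge0_reK //; congr (iota _).
  by rewrite /B -n0x2 -[n0 x]ge0_reK // -rmorphXn !iotaK sqrtr_sqr ger0_norm ?re_ge0.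
have F_subR : @is_subspace R (realify iota X) F.
  by split=> // a x y; exact: F_sub.2.
have B_lin (a : R) (x y z : realify iota X) : F x -> F y -> F z ->
    B (a *: x + y) z = a * B x z + B y z.
  by move=> Fx Fy Fz; rewrite /B realify_scaleE ip_lin // reD re_scale.
have B_sym x y : F x -> F y -> B y x = B x y.
  by move=> Fx Fy; rewrite /B ip_sym // re_conj.
have B_ge0 x : F x -> 0 <= B x x by move=> Fx; apply: re_ge0; exact: ip_ge0.
(* Continuity of the identity at 0, from (B1), is turned into a norm inequality by homogeneity. *)
have [C C0 NB] : exists2 C, 0 <= C & forall x : X, F x -> rnorm x ^+ 2 <= C * B x x.
  have [d d0 Hd] := B1 0 F0 1 ltr01.
  exists ((2 / re d) ^+ 2) => [|x Fx]; first exact: sqr_ge0.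
  rewrite -[B x x]sqr_sqrtr ?B_ge0 // -exprMn lerXn2r ?nnegrE ?rnorm_ge0 //.
    by rewrite mulr_ge0 ?sqrtr_ge0 // divr_ge0 // ltW // re_gt0.
  pose p (x : realify iota X) := Num.sqrt (B x x).
  apply: (@homogeneous_bound R (realify iota X) F p (@rnorm X)) Fx => //.
  - exact: re_gt0.
  - move=> r y Fy; rewrite /p (innerZZ F_subR B_lin B_sym) //.
    by rewrite sqrtrM ?sqr_ge0 // sqrtr_sqr.
  - by move=> r y _; exact: rnormZ.
  - by move=> y _; exact: sqrtr_ge0.
  move=> y Fy py; rewrite rnorm_lt rmorph1 -[y]subr0; apply: Hd => //.
  by rewrite subr0 n0E // -[d]ge0_reK ?ltr_iota // ltW.
have T_linR : @is_linear R (realify iota X) (realify iota X) T.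
  by move=> a u v; rewrite !realify_scaleE T_lin.
pose M := 1 + `|re M0|.
have M1 : 1 <= M by rewrite lerDl.
have NT (x : X) : rnorm (T x) <= M * rnorm x.
  apply: le_trans (re_le (TM x)) _; rewrite -iota_rnorm mulrC re_scale mulrC.
  by rewrite ler_wpM2r ?rnorm_ge0 // (le_trans (ler_norm _)) // lerDr.
have BT x : F x -> B (T x) (T x) = B x x.
  by move=> Fx; rewrite /B -(n0P _ (FT _ Fx)).2 B2 // (n0P _ Fx).2.
have T_mixing x y : F x -> F y -> forall e : R, 0 < e ->
    exists n, forall m, (n <= m)%N -> `|B (iter m T x) y| < e.
  move=> Fx Fy e e0; have /cvgr0Pnorm_lt := B2' x y Fx Fy.
  move=> /(_ (iota e)) [|n _ Hn]; first by rewrite iota_gt0.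
  exists n => m nm; apply: le_lt_trans (norm_re_le _) _.
  by rewrite -ltr_iota ge0_reK //; exact: Hn.
have T_iter0 n : iter n T 0 = 0.
  by elim: n => //= n ->; exact: (is_linear0 T_lin).
(* The closure condition yields small terms but not late ones. For nonzero [x] no term of the
   backward orbit vanishes, so a term smaller than the first [n] of them has index at least [n]. *)
have T_backward x : F x -> forall e : R, 0 < e -> forall n,
    exists m v, [/\ (n <= m)%N, iter m T v = x & rnorm v < e].
  move=> Fx e e0 n; have [->|x0] := eqVneq x 0.
    by exists n, 0; split; rewrite ?T_iter0 ?rnorm0.
  have [xs [[xs0 xsS] xs_cl]] := B3 x Fx.
  have T_xs m : iter m T (xs m) = x.
    by elim: m => [//|m IHm]; rewrite iterSr xsS.
  have xs_gt0 m : 0 < rnorm (xs m).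
    rewrite lt_def rnorm_ge0 andbT; apply: contra_neq x0 => /rnorm_eq0 xm0.
    by rewrite -(T_xs m) xm0 T_iter0.
  have [d d0 Hd] : exists2 d, 0 < d & forall m, (m < n)%N -> d <= rnorm (xs m).
    elim: n => [|n [d d0 Hd]]; first by exists 1.
    exists (Num.min d (rnorm (xs n))) => [|m]; first by rewrite lt_min d0 xs_gt0.
    rewrite ltnS leq_eqVlt ge_min => /orP[/eqP ->|/Hd ->//].
    by rewrite lexx orbT.
  have [|_ [[m _ <-]]] := xs_cl (ball 0 (iota (Num.min d e))).
    by apply: nbhsx_ballx; rewrite iota_gt0 lt_min d0.
  rewrite -ball_normE /= sub0r normrN -rnorm_lt lt_min => /andP[xd xe].
  exists m, (xs m); split=> //; rewrite leqNgt; apply/negP => /Hd.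
  by rewrite leNgt xd.
have [z [Fz z_dense]] := separable_dense_sequence X_sep F_dense.
have [x Hx] := @real_weakly_dense_orbit R (realify iota X) F B F_subR B_lin B_sym
  (@rnorm X) T M C (rnorm0 X) (@rnormD X) (@rnormN X) NB C0 (@geometric_complete X)
  T_linR M1 NT FT BT T_mixing T_backward z Fz z_dense.
exists x => x0 k f f_lin f_cont e e0.
(* Each functional over K is split into two real ones, its real part and the real part of its
   multiple by [c]. *)
pose fr (j : 'I_k * bool) (v : X) := re (if j.2 then f j.1 v else c * f j.1 v).
have fr_lin j : @is_linear R (realify iota X) R^o (fr j).
  move=> a u v; rewrite /fr realify_scaleE f_lin; case: ifP => _.
    by rewrite reD re_scale.
  by rewrite mulrDr reD /GRing.scale /= mulrCA re_scale.
have fr_bounded j : exists C', forall v, `|fr j v| <= C' * rnorm v.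
  have [C' HC'] := continuous_linear_bounded (f_lin j.1) (f_cont j.1).
  rewrite /fr; case: j.2.
    by exists C' => v; apply: le_trans (norm_re_le _) (HC' v).
  exists (re `|c| * C') => v; apply: le_trans (norm_re_le _) _.
  by rewrite normrM -[`|c|]ge0_reK // re_scale iotaK -mulrA ler_wpM2l ?HC' ?re_ge0.
have [|n Hn] := Hx x0 _ fr fr_lin fr_bounded (re e / 2).
  by rewrite divr_gt0 // re_gt0.
exists (iter n T x); first by exists n.
move=> j; rewrite -[e]ge0_reK; last exact: ltW.
rewrite -[X in X < _]ge0_reK // ltr_iota.
apply: le_lt_trans (re_norm_le _) _; rewrite [re e]splitr ltrD //.
  by have := Hn (j, true); rewrite /fr /= -reB.
by have := Hn (j, false); rewrite /fr /= -reB -mulrBr.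
Qed.

End Reduction.

(* K = R (any realType, conjugation = identity) or K = C = R[i]. *)
Theorem theorem1p3 :
  (forall (R : realType) (X : completeNormedModType R),
      theorem1p3_statement (fun a : R => a) X) /\
  (forall (R : realType) (X : completeNormedModType R[i]),
      theorem1p3_statement (@conjc R) X).
Proof.
split=> R X.
  (* Over the reals there is no imaginary part, whence [c = 0]. *)
  apply: (@weakly_hypercyclic_criterion R R idfun id 0) => // a.
  by rewrite lerDl.
apply: (@weakly_hypercyclic_criterion R R[i] (real_complex R)
  (@complex.Re R) (0 -i* 1)%C (@conjc R)).
- by move=> [a b] [a' b'].
- by move=> r [a b] /=; rewrite mul0r subr0.
- by move=> [a b]; rewrite lecE /= => /andP[/eqP -> _].
- exact: lecR.
- by move=> [a b]; rewrite normc_def /= -sqrtr_sqr ler_wsqrtr // lerDl sqr_ge0.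
- move=> [a b]; rewrite normc_def /= mul0r sub0r mulN1r opprK.
  rewrite -[leRHS]ger0_norm ?addr_ge0 // -sqrtr_sqr ler_wsqrtr //.
  by rewrite sqrrD !real_normK ?num_real // addrAC lerDl mulrn_wge0 // mulr_ge0.
- by case.
Qed.
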